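(* Let $p$ be an $n$-component Gauss phrase and let $1\le k\le n$. Then $O_k(p)$ contains an even number of $k$-odd orbits.
   Context: A word on an alphabet (finite set) $\mathcal{A}$ is a finite, possibly empty, sequence of letters of $\mathcal{A}$. A Gauss word on $\mathcal{A}$ is a word on $\mathcal{A}$ in which every letter of $\mathcal{A}$ appears exactly twice. A Gauss phrase on $\mathcal{A}$ is a finite sequence of words $x_1,\dots,x_m$ on $\mathcal{A}$ whose concatenation $x_1x_2\cdots x_m$ is a Gauss word on $\mathcal{A}$; the $x_i$ are its components. Write $K_n=(\mathbb{Z}/2\mathbb{Z})^n$. Let $p$ be an $n$-component Gauss phrase. For a (contiguous) subword $w$ of a component of $p$, the linking vector $\overrightarrow{l(w)}\in K_n$ is the vector whose $i$th entry is the number, modulo $2$, of letters which occur exactly once in $w$ and whose other occurrence is in the $i$th component of $p$. A single-component letter is a letter both of whose occurrences are in the same component. If $A$ is a single-component letter in the $k$th component, that component has the form $xAyAz$ with $x,y,z$ possibly empty words, and the linking vector of $A$ is $\overrightarrow{l(A)}=\overrightarrow{l(y)}$. For $\vec u\in K_n$, let $c_{\vec u}:K_n\to K_n$, $c_{\vec u}(\vec v)=\vec u+\vec v$, and let $K(\vec u)$ be the set of orbits of $K_n$ under $c_{\vec u}$ (so the orbit of $\vec v$ is $[\vec v]=\{\vec v,\vec u+\vec v\}$). Let $\vec l_k$ be the linking vector of the whole $k$th component of $p$, let $\mathcal{A}_k$ be the set of single-component letters appearing in the $k$th component, and for $[\vec v]\in K(\vec l_k)$ let $d_k([\vec v])=\#\{X\in\mathcal{A}_k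 : \overrightarrow{l(X)}\in[\vec v]\}$. Define $$O_k(p)=\{[\vec v]\in K(\vec l_k)-\{[\vec 0]\} : d_k([\vec v])\text{ is odd}\}.$$ The $k$th entry of $\vec l_k$ is $0$, so all vectors in an orbit in $K(\vec l_k)$ have the same $k$th entry; the orbit is called $k$-odd if this entry is $1$. *)

(* Defs.v *)
From mathcomp Require Import all_boot all_order all_algebra.

Set Implicit Arguments.
Unset Strict Implicit.
Unset Printing Implicit Defensive.

Import GRing.Theory.
Local Open Scope ring_scope.

Definition gauss_word (A : finType) (w : seq A) : Prop :=
  forall a : A, count_mem a w = 2%N.

Definition gauss_phrase (A : finType) (n : nat) (p : n.-tuple (seq A)) : Prop :=
  gauss_word (flatten p).

(* For [w] a subword of the [k]th component of [p], the number of occurrences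
   of [a] in the [i]th component that are not occurrences in [w]. *)
Definition outside (A : finType) (n : nat) (p : n.-tuple (seq A)) (k : 'I_n)
    (w : seq A) (i : 'I_n) (a : A) : nat :=
  (count_mem a (tnth p i) - (if i == k then count_mem a w else 0))%N.

(* The index [k] records which component contains the subword [w]: it is needed
   to tell the occurrence of a letter in [w] from its other occurrence. *)
Definition link (A : finType) (n : nat) (p : n.-tuple (seq A)) (k : 'I_n)
    (w : seq A) : 'rV['Z_2]_n :=
  \row_(i < n)
    #|[set a : A | (count_mem a w == 1%N) && (0 < outside p k w i a)%N]|%:R.

(* The word strictly between the first two occurrences of [a] in [w]. *)
Definition between (A : finType) (a : A) (w : seq A) : seq A :=
  let s := drop (index a w).+1 w in take (index a s) s.

Lemma betweenE (A : finType) (a : A) (x y z : seq A) :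
  a \notin x -> a \notin y -> between a (x ++ a :: y ++ a :: z) = y.
Proof.
move=> ax ay; rewrite /between index_cat (negbTE ax) /= eqxx addn0.
rewrite -cat_rcons drop_size_cat ?size_rcons //.
by rewrite index_cat (negbTE ay) /= eqxx addn0 take_size_cat.
Qed.

Definition single_letters (A : finType) (n : nat) (p : n.-tuple (seq A))
    (k : 'I_n) : {set A} :=
  [set a : A | count_mem a (tnth p k) == 2%N].

Definition letter_link (A : finType) (n : nat) (p : n.-tuple (seq A))
    (k : 'I_n) (a : A) : 'rV['Z_2]_n :=
  link p k (between a (tnth p k)).

Definition comp_link (A : finType) (n : nat) (p : n.-tuple (seq A))
    (k : 'I_n) : 'rV['Z_2]_n :=
  link p k (tnth p k).

Definition translate (n : nat) (u v : 'rV['Z_2]_n) : 'rV['Z_2]_n := u + v.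

Definition orbit_of (n : nat) (u v : 'rV['Z_2]_n) : {set 'rV['Z_2]_n} :=
  [set w in orbit (translate u) v].

Definition orbits (n : nat) (u : 'rV['Z_2]_n) : {set {set 'rV['Z_2]_n}} :=
  [set orbit_of u v | v : 'rV['Z_2]_n].

Lemma orbE (n : nat) (u v : 'rV['Z_2]_n) : orbit_of u v = [set v; u + v].
Proof.
have uu : u + u = 0.
  by apply/rowP => i; rewrite !mxE; case: (u 0 i) => -[|[|//]] ?; apply/val_inj.
have itE m : iter m (translate u) v = if odd m then u + v else v.
  by elim: m => //= m ->; case: odd; rewrite /translate //= addrA uu add0r.
apply/setP => w; rewrite !inE -fconnect_orbit; apply/idP/idP.
  by move/iter_findex; rewrite itE; case: odd => <-; rewrite eqxx ?orbT.
by case/orP => /eqP->; [exact: connect0 | exact: fconnect1].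
Qed.

Definition orbit_count (A : finType) (n : nat) (p : n.-tuple (seq A)) (k : 'I_n)
    (o : {set 'rV['Z_2]_n}) : nat :=
  #|[set a in single_letters p k | letter_link p k a \in o]|.

Definition O_set (A : finType) (n : nat) (p : n.-tuple (seq A)) (k : 'I_n) :
    {set {set 'rV['Z_2]_n}} :=
  [set o in orbits (comp_link p k) :\ orbit_of (comp_link p k) 0 | odd (orbit_count p k o)].

Definition k_odd (n : nat) (k : 'I_n) (o : {set 'rV['Z_2]_n}) : bool :=
  [forall v in o, v 0 k == 1].

Lemma comp_link_diag (A : finType) (n : nat) (p : n.-tuple (seq A))
    (k : 'I_n) : comp_link p k 0 k = 0.
Proof.
rewrite mxE (_ : [set a | _] = set0) ?cards0 //.
by apply/setP => a; rewrite !inE /outside eqxx subnn andbF.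
Qed.

(* The [k]th entry is constant on each orbit, so quantifying universally in
   [k_odd] is no stronger than looking at one representative. *)
Lemma k_odd_orb (A : finType) (n : nat) (p : n.-tuple (seq A)) (k : 'I_n)
    (v : 'rV['Z_2]_n) : k_odd k (orbit_of (comp_link p k) v) = (v 0 k == 1).
Proof.
rewrite orbE; apply/forall_inP/idP => [-> // | v1 w]; first by rewrite !inE eqxx.
by rewrite !inE => /orP[] /eqP-> //; rewrite mxE comp_link_diag add0r.
Qed.

(* Main.v *)
Require Import Defs.
From mathcomp Require Import all_boot all_order all_algebra.

(** An orbit is [k]-odd when its vectors have [k]th entry [1], so [[0]] is not
[k]-odd, and modulo 2 the number of [k]-odd orbits in [O_k(p)] is the number of
single-component letters [X] of the [k]th component such that [l(X)] has [k]th
entry [1].  That entry counts modulo 2 the letters interlaced with [X] in the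
[k]th component.  Interlacement is symmetric and irreflexive, so by the
handshake lemma an even number of letters is interlaced with an odd number of
others. *)

Set Implicit Arguments.
Unset Strict Implicit.
Unset Printing Implicit Defensive.

Import GRing.Theory.

Lemma odd_sum (I : finType) (P : pred I) (F : I -> nat) :
  odd (\sum_(i | P i) F i) = odd #|[set i | P i && odd (F i)]|.
Proof.
rewrite -sum1dep_card big_mkcondr /=.
elim/big_rec2: _ => // i m s _ eq_ms.
by rewrite !oddD eq_ms; case: (odd (F i)).
Qed.

Lemma sum_card_rel (T : finType) (P : pred T) (r : rel T) :
  \sum_(a | P a) #|[set b | r a b]| = #|[set x : T * T | P x.1 && r x.1 x.2]|.
Proof.
rewrite -sum1dep_card -(pair_big_dep P r (fun _ _ => 1)) /=.
by apply: eq_bigr => a _; rewrite sum1dep_card.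
Qed.

(** Ordering the elements by [enum_rank] splits the pairs in [r] into increasing and decreasing
    ones, as none is diagonal; swapping coordinates matches the two halves. *)
Lemma even_card_sym_irrefl (T : finType) (r : rel T) :
  symmetric r -> irreflexive r -> ~~ odd #|[set x : T * T | r x.1 x.2]|.
Proof.
move=> r_sym r_irr; rewrite -sum1dep_card.
rewrite (bigID (fun x => enum_rank x.1 < enum_rank x.2)) /=.
rewrite [X in _ + X](reindex_inj (can_inj (@swap_pairK T T))) /=.
rewrite [X in _ + X](eq_bigl
  (fun x => r x.1 x.2 && (enum_rank x.1 < enum_rank x.2))).
  by rewrite addnn odd_double.
move=> [a b] /=; rewrite r_sym -leqNgt leq_eqVlt.
case: (eqVneq a b) => [-> | ab]; first by rewrite r_irr.
by rewrite val_eqE (inj_eq enum_rank_inj) (negbTE ab).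
Qed.

(** Modulo 2 this is the sum of all degrees, which counts the ordered pairs in [r]. *)
Lemma odd_degrees_even (T : finType) (r : rel T) :
  symmetric r -> irreflexive r ->
  ~~ odd #|[set a | odd #|[set b | r a b]|]|.
Proof.
move=> r_sym r_irr.
rewrite -(odd_sum xpredT (fun a => #|[set b | r a b]|)) sum_card_rel.
exact: even_card_sym_irrefl.
Qed.

(** Cutting at the first occurrence of [a] gives the shape that [betweenE] needs. *)
Lemma count_mem_split (A : eqType) (a : A) (w : seq A) (m : nat) :
  count_mem a w = m.+1 ->
  exists x y, [/\ w = x ++ a :: y, a \notin x & count_mem a y = m].
Proof.
elim: w => //= b w IHw; case: (eqVneq b a) => [-> [cw] | ba].
  by exists [::], w.
rewrite add0n => /IHw[x [y [-> ax cy]]]; exists (b :: x), y; split=> //.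
by rewrite inE negb_or eq_sym ba.
Qed.

(** The condition looks only between the occurrences of [a], to match [letter_link]; its symmetry is
    a lemma. *)
Definition interlaced (A : finType) (w : seq A) : rel A := fun a b =>
  [&& count_mem a w == 2, count_mem b w == 2 &
      count_mem b (between a w) == 1].

Lemma interlaced_symW (A : finType) (w : seq A) (a b : A) :
  interlaced w a b -> interlaced w b a.
Proof.
rewrite /interlaced => /and3P[ca cb]; rewrite ca cb /=.
have [x [s [Dw ax /count_mem_split[y [z [Ds ay caz]]]]]] :=
  count_mem_split (eqP ca).
rewrite {}Dw {}Ds {w s ca} in cb *; rewrite betweenE // => /eqP cby.
have ab : (a == b) = false.
  by apply: contraTF isT => /eqP ab; move/count_memPn: ay; rewrite ab cby.
move: cb; rewrite count_cat /= count_cat /= cby ab /= add0n add1n addnS.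
rewrite eqSS add0n.
have [y1 [y2 [Dy by1 /count_memPn by2]]] := count_mem_split cby.
move: ay; rewrite {}Dy {cby} mem_cat inE !negb_or => /and3P[ay1 _ ay2].
have cnt1 (s1 s2 : seq A) : a \notin s1 -> a \notin s2 ->
    count_mem a (s1 ++ a :: s2) == 1.
  by move=> /count_memPn a1 /count_memPn a2; rewrite count_cat /= eqxx a1 a2.
(* One [b] lies between the two [a]s, so the other is in [x] or in [z]. If it is in [z], the word is
   [x a y1 b y2 a z1 b z2], and [y2 a z1] contains [a] once. *)
case cbx: (count_mem b x) => [|m].
  have bx : b \notin x by apply/count_memPn.
  move=> /eqP/count_mem_split[z1 [z2 [Dz bz1 _]]].
  move/count_memPn: caz; rewrite {}Dz mem_cat negb_or => /andP[az1 _].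
  rewrite (_ : x ++ _ = (x ++ a :: y1) ++ b :: (y2 ++ a :: z1) ++ b :: z2).
    rewrite betweenE ?cnt1 // mem_cat inE !negb_or eq_sym ab.
    - by rewrite bx.
    - by rewrite by2.
  by rewrite -!(catA, cat_cons).
(* Otherwise the word is [x1 b x2 a y1 b y2 a z], and [x2 a y1] contains [a] once. *)
rewrite addSn eqSS addn_eq0 => /andP[/eqP m0 _]; rewrite {}m0 in cbx.
have [x1 [x2 [Dx bx1 /count_memPn bx2]]] := count_mem_split cbx.
move: ax; rewrite {}Dx mem_cat inE !negb_or => /and3P[ax1 _ ax2].
rewrite (_ : (x1 ++ _) ++ _ =
  x1 ++ b :: (x2 ++ a :: y1) ++ b :: (y2 ++ a :: z)).
  by rewrite betweenE ?cnt1 // mem_cat inE !negb_or eq_sym ab bx2.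
by rewrite -!(catA, cat_cons).
Qed.

Lemma interlaced_sym (A : finType) (w : seq A) : symmetric (interlaced w).
Proof. by move=> a b; apply/idP/idP; apply: interlaced_symW. Qed.

Lemma interlaced_irrefl (A : finType) (w : seq A) : irreflexive (interlaced w).
Proof.
move=> a; apply: contraTF isT => /and3P[/eqP/count_mem_split[x [s []]]].
move=> -> ax /count_mem_split[y [z [-> ay _]]] _.
by rewrite betweenE // (count_memPn ay).
Qed.

Lemma Z2_natr_eq1 (m : nat) : ((m%:R : 'Z_2) == 1)%R = odd m.
Proof. by rewrite -val_eqE /= val_Zp_nat // modn2; case: (odd m). Qed.

Lemma count_tnth_flatten (A : eqType) (n : nat) (p : n.-tuple (seq A))
    (P : pred A) (k : 'I_n) : count P (tnth p k) <= count P (flatten p).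
Proof.
have /splitPr[s1 s2] := mem_tnth k p.
by rewrite flatten_cat /= !count_cat addnCA leq_addr.
Qed.

(** A letter met once between the two [a]s has its other occurrence in component [k] exactly when it
    occurs there twice, since the Gauss condition allows at most two occurrences. *)
Lemma letter_link_diag (A : finType) (n : nat) (p : n.-tuple (seq A))
    (k : 'I_n) (a : A) :
  gauss_phrase p -> a \in single_letters p k ->
  (letter_link p k a ord0 k == 1)%R =
    odd #|[set b | interlaced (tnth p k) a b]|.
Proof.
move=> hp; rewrite inE => ca; rewrite mxE Z2_natr_eq1.
congr (odd #|pred_of_set _|).
apply/setP => b; rewrite !inE /interlaced ca /outside eqxx /= andbC.
have := count_tnth_flatten p (pred1 b) k; rewrite hp.
case: (count_mem b (between a _) =P 1); rewrite ?andbF // => ->.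
by case: (count_mem b _) => [|[|[|]]].
Qed.

(** Translation by [u] is an involution, so either element of an orbit generates it. *)
Lemma mem_orbit_of (n : nat) (u v : 'rV['Z_2]_n) o :
  o \in orbits u -> (v \in o) = (orbit_of u v == o).
Proof.
case/imsetP=> w _ ->; apply/idP/eqP => [|<-]; last by rewrite orbE !inE eqxx.
have uu : (u + u = 0)%R.
  by apply/rowP => i; rewrite !mxE; case: (u _ i) => -[|[|//]] ?; apply/val_inj.
rewrite !orbE !inE => /orP[] /eqP-> //.
by rewrite addrA uu add0r setUC.
Qed.

(** Each letter is counted in exactly one orbit, that of its linking vector, and this vector decides
    whether the orbit is [k]-odd. *)
Lemma sum_orbit_count (A : finType) (n : nat) (p : n.-tuple (seq A))
    (k : 'I_n) :
  \sum_(o in orbits (comp_link p k) | k_odd k o) orbit_count p k o =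
    #|[set a in single_letters p k | (letter_link p k a ord0 k == 1)%R]|.
Proof.
rewrite -sum1dep_card.
rewrite (partition_big (fun a => orbit_of (comp_link p k) (letter_link p k a))
  (fun o => (o \in orbits (comp_link p k)) && k_odd k o)) /=; last first.
  by move=> a /andP[_ a1]; rewrite imset_f // k_odd_orb.
apply: eq_bigr => o /andP[orb_o odd_o].
rewrite /orbit_count -sum1dep_card; apply: eq_bigl => a.
rewrite (mem_orbit_of _ orb_o) -andbA; case: eqP => [Do|]; rewrite ?andbF //.
by have := k_odd_orb p k (letter_link p k a); rewrite Do odd_o => <-.
Qed.

Theorem proposition7p1 (A : finType) (n : nat) (p : n.-tuple (seq A))
    (hp : gauss_phrase p) (k : 'I_n) :
  ~~ odd #|[set o in O_set p k | k_odd k o]|.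
Proof.
rewrite (_ : [set o in _ | _] = [set o | ((o \in orbits (comp_link p k))
  && k_odd k o) && odd (orbit_count p k o)]); last first.
  apply/setP => o; rewrite !inE.
  case: eqP => [-> | _]; last by rewrite /= andbAC.
  by rewrite k_odd_orb mxE !andbF.
rewrite -odd_sum sum_orbit_count.
rewrite (_ : [set a in _ | _] =
  [set a | odd #|[set b | interlaced (tnth p k) a b]|]).
  exact: odd_degrees_even (@interlaced_sym _ _) (@interlaced_irrefl _ _).
apply/setP => a; rewrite !inE.
case: (boolP (a \in single_letters p k)) => [sa | nsa].
  by rewrite -letter_link_diag //; move: sa; rewrite inE => ->.
(* A letter that is not single-component in component [k] is interlaced with nothing, so its degree
   0 is even. *)
move: nsa; rewrite inE => /negbTE nsa; rewrite nsa.
rewrite (_ : [set b | _] = set0) ?cards0 //.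
by apply/setP => b; rewrite !inE /interlaced nsa.
Qed.
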